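(* Let $G$ be a connected graph and $e\in E(G)$ an edge such that $G-e$ is connected. (i) $\mu_t(G-e)\le \mu_t(G)+2$, and this inequality is sharp (there exist such $G$ and $e$ with $\mu_t(G-e)=\mu_t(G)+2$). (ii) There are no constants $a>0$ and $b$ such that $a\cdot\mu_t(G)+b\le \mu_t(G-e)$ holds for every connected graph $G$ and every edge $e\in E(G)$ with $G-e$ connected.
   Context: All graphs are finite, simple and connected. For a connected graph $G$ and $X\subseteq V(G)$, two vertices $u,v$ are $X$-visible if there is a shortest $u,v$-path $P$ in $G$ with $V(P)\cap X\subseteq\{u,v\}$. A set $X\subseteq V(G)$ is a total mutual-visibility set if every two vertices $u,v\in V(G)$ are $X$-visible; the total mutual-visibility number $\mu_t(G)$ is the maximum cardinality of a total mutual-visibility set in $G$. $G-e$ denotes the graph obtained by deleting the edge $e$. *)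

(* Defs.v *)
From HB Require Import structures.
From mathcomp Require Import all_boot all_order all_algebra.
From mathcomp Require Import boolp reals.

Set Implicit Arguments.
Unset Strict Implicit.
Unset Printing Implicit Defensive.

Record sgraph := SGraph {
  vertex :> finType;
  adj : rel vertex;
  adj_sym : symmetric adj;
  adj_irrefl : irreflexive adj
}.

Definition connected (G : sgraph) : Prop :=
  0 < #|G| /\ forall u v : G, connect (@adj G) u v.

Definition edges (G : sgraph) : {set {set G}} :=
  [set [set x; y] | x in G, y in G & adj x y].

Section DeleteEdge.
Variables (G : sgraph) (e : {set G}).

Definition del_adj : rel G := fun x y => adj x y && ([set x; y] != e).

Lemma del_adj_sym : symmetric del_adj.
Proof. by move=> x y; rewrite /del_adj adj_sym setUC. Qed.

Lemma del_adj_irrefl : irreflexive del_adj.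
Proof. by move=> x; rewrite /del_adj adj_irrefl. Qed.

Definition del_edge : sgraph := SGraph del_adj_sym del_adj_irrefl.

End DeleteEdge.

(* The path with vertices u :: p, from u to v; its length is size p. *)
Definition is_path (G : sgraph) (u v : G) (p : seq G) : Prop :=
  [/\ path (@adj G) u p, last u p = v & uniq (u :: p)].

Definition is_shortest_path (G : sgraph) (u v : G) (p : seq G) : Prop :=
  is_path u v p /\ forall q : seq G, is_path u v q -> size p <= size q.

Definition visible (G : sgraph) (X : {set G}) (u v : G) : Prop :=
  exists2 p : seq G, is_shortest_path u v p &
    [set z in u :: p] :&: X \subset [set u; v].

Definition total_mutual_visibility_set (G : sgraph) (X : {set G}) : Prop :=
  forall u v : G, visible X u v.

Definition mu_t (G : sgraph) : nat :=
  \max_(X : {set G} | `[< total_mutual_visibility_set X >]) #|X|.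

(* Main.v *)
Require Import Defs.
From HB Require Import structures.
From mathcomp Require Import all_boot all_order all_algebra.
From mathcomp Require Import boolp reals.

Set Implicit Arguments.
Unset Strict Implicit.
Unset Printing Implicit Defensive.

Import Order.TTheory GRing.Theory Num.Theory.

(** For (i), if [X] is a total mutual-visibility set of [G - e], then so is
    [X :\: e] in [G]: either the distance from [u] to [v] does not change, or a
    geodesic of [G] crosses [e] exactly once, and its two pieces may be replaced
    by geodesics of [G - e] whose interiors avoid [X].  The bound is attained by
    deleting an edge of the 5-cycle: the middle of every 2-path is forced out of
    [X] in the cycle, whereas the two leaves of the resulting path can be taken.
    For (ii), take the prism over a star with [n] leaves, i.e. two stars whose
    corresponding vertices are matched, and let [e] join the two centers.  Geodesics
    can be routed through the centers, so the leaves form a total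
    mutual-visibility set; once [e] is deleted, every vertex is the unique
    common neighbour of two nonadjacent vertices, so only the empty set is left. *)

Lemma eq_set2 (T : finType) (a b c d : T) :
  ([set a; b] == [set c; d]) =
  ((a == c) && (b == d)) || ((a == d) && (b == c)).
Proof.
apply/eqP/idP => [E|/orP[]/andP[/eqP-> /eqP->] //]; last by rewrite setUC.
have : a \in [set c; d] by rewrite -E set21.
have : b \in [set c; d] by rewrite -E set22.
have : c \in [set a; b] by rewrite E set21.
have : d \in [set a; b] by rewrite E set22.
rewrite !inE (eq_sym d a) (eq_sym d b) (eq_sym c a) (eq_sym c b).
by case: (a == c); case: (a == d); case: (b == c); case: (b == d).
Qed.

(** * Geodesics, visibility and bounds on [mu_t] *)

Section Geodesics.
Variable G : sgraph.
Implicit Types (u v w z : G) (p q : seq G) (X : {set G}).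

(** Minimality is tested against all walks and distinctness of vertices is dropped, so concatenated
    walks can be handled without checking for repetitions. Shortening a walk shows that nothing
    changes. *)
Definition geodesic u v p : Prop :=
  [/\ path (@adj G) u p, last u p = v &
      forall q, path (@adj G) u q -> last u q = v -> size p <= size q].

Lemma is_shortest_pathP u v p : is_shortest_path u v p <-> geodesic u v p.
Proof.
split=> [[[pp pl pu] pmin]|[pp pl pmin]].
  split=> // q qp ql; case/shortenP: qp ql => q' q'p q'u q'q ql.
  have sub : {subset q' <= q} by move=> x; apply: q'q.
  apply: (leq_trans (pmin q' _)) => //.
  by apply: uniq_leq_size => //; case/andP: q'u.
split; last by move=> q [qp ql _]; apply: pmin.
split=> //; case/shortenP: (pp) (pl) => q' q'p q'u q'q ql.
apply: (leq_size_uniq q'u) => /=; last by rewrite ltnS pmin.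
move=> x; rewrite !inE => /orP[->//|xq].
by rewrite (q'q _ xq) orbT.
Qed.

Lemma exists_geodesic u v : connect (@adj G) u v -> exists p, geodesic u v p.
Proof.
move=> /connectP[p0 p0p p0l].
pose P n := `[< exists p, [/\ path (@adj G) u p, last u p = v & size p = n] >].
have exP : exists n, P n by exists (size p0); apply/asboolP; exists p0.
have [n /asboolP[p [pp pl ps]] nmin] := ex_minnP exP.
exists p; split=> // q qp ql; rewrite ps; apply: nmin.
by apply/asboolP; exists q.
Qed.

Lemma geodesic_visible X u v p :
  geodesic u v p ->
  (forall z, z \in u :: p -> z \in X -> z = u \/ z = v) -> visible X u v.
Proof.
move=> gp pX; exists p; first exact/is_shortest_pathP.
apply/subsetP => z; rewrite inE inE => /andP[zp zX].
by rewrite !inE; have [->|->] := pX z zp zX; rewrite eqxx ?orbT.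
Qed.

Lemma visible_geodesic X u v :
  visible X u v -> exists2 p, geodesic u v p &
    forall z, z \in u :: p -> z \in X -> z = u \/ z = v.
Proof.
case=> p /is_shortest_pathP gp /subsetP pX; exists p => // z zp zX.
by have := pX z; rewrite 2!inE zp zX => /(_ isT); rewrite !inE => /orP[]/eqP; auto.
Qed.

(** Here [u] and [v] are at distance 2 and [w] is their only common neighbour, so every geodesic
    between them has [w] in its interior. *)
Lemma unique_middle_notin X u v w :
  visible X u v -> adj u w -> adj w v -> u != v -> ~~ adj u v ->
  (forall z, adj u z -> adj z v -> z = w) -> w \notin X.
Proof.
move=> /visible_geodesic[p [pp pl pmin] pX] uw wv uv nuv uniqw.
have uw_neq : w != u by apply: contraTneq uw => ->; rewrite adj_irrefl.
have wv_neq : w != v by apply: contraTneq wv => ->; rewrite adj_irrefl.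
apply/negP => wX.
have := pmin [:: w; v]; rewrite /= uw wv => /(_ isT erefl) p2.
have wp : w \in u :: p.
  case: p pp pl p2 {pmin pX} => [|a [|b [|//]]] /=.
  - by move=> _ E; rewrite E eqxx in uv.
  - by move=> /andP[ua _] E; rewrite E (negPf nuv) in ua.
  - move=> /and3P[ua ab _] E _; rewrite E in ab.
    by rewrite (uniqw a ua ab) !inE eqxx orbT.
have [E|E] := pX w wp wX; first by rewrite E eqxx in uw_neq.
by rewrite E eqxx in wv_neq.
Qed.

(** Serves as a certificate of minimality: a candidate distance function that grows by at most 1
    along each edge bounds the length of every walk from below. *)
Lemma path_lipschitz (f : G -> nat) u p :
  (forall x y, adj x y -> f y <= f x + 1) ->
  path (@adj G) u p -> f (last u p) <= f u + size p.
Proof.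
move=> fL; elim: p u => [|a p IH] u /=; first by rewrite addn0.
move=> /andP[/fL ua /IH]; move/leq_trans; apply.
by rewrite -add1n addnA leq_add2r.
Qed.

(** An interior vertex of a path has a predecessor and a successor; for a vertex of degree at most 1
    they would coincide, contradicting distinctness. So any geodesic will do. *)
Lemma leaves_total_mutual_visibility_set X :
  connected G ->
  (forall x y z, x \in X -> adj x y -> adj x z -> y = z) ->
  total_mutual_visibility_set X.
Proof.
move=> [_ conn] leaf u v.
have [p gp] := exists_geodesic (conn u v); apply: (geodesic_visible gp).
have [[pp pl pu] _] := iffRL (is_shortest_pathP u v p) gp.
move=> z; rewrite inE => /orP[/eqP->|zp zX]; first by left.
case/splitPr: zp pp pl pu => p1 [|t p2]; rewrite cat_path last_cat /=.
  by move=> _ <-; right.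
move=> /and4P[_ wz zt _] _.
rewrite adj_sym in wz; rewrite -(leaf z _ _ zX wz zt).
rewrite -[_ && _]/(uniq ((u :: p1) ++ _)) cat_uniq.
move=> /and3P[_ /hasPn/(_ (last u p1)) + _].
by rewrite !inE eqxx orbT => /(_ isT); rewrite -in_cons mem_last.
Qed.

Lemma mu_t_leqP n :
  reflect (forall X, total_mutual_visibility_set X -> #|X| <= n) (mu_t G <= n).
Proof.
apply: (iffP (bigmax_leqP _ _ _)) => H X; first by move=> /asboolP/H.
by move=> /asboolP; apply: H.
Qed.

Lemma leq_mu_t X : total_mutual_visibility_set X -> #|X| <= mu_t G.
Proof. by move: X; apply/mu_t_leqP. Qed.

Lemma mu_t_eq0 :
  (forall X w, total_mutual_visibility_set X -> w \notin X) -> mu_t G = 0.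
Proof.
move=> H; apply/eqP; rewrite -leqn0; apply/mu_t_leqP => X tX.
rewrite leqn0 cards_eq0; apply/eqP/setP => w; rewrite inE.
exact/negbTE/H.
Qed.

End Geodesics.

(** * The upper bound for edge deletion *)

Section EdgeDeletion.
Variables (G : sgraph) (e : {set G}).

Lemma del_adj_adj : subrel (del_adj e) (@adj G).
Proof. by move=> x y /andP[]. Qed.

Lemma connected_del_edge : connected (del_edge e) -> connected G.
Proof.
move=> [G0 conn]; split=> // u v; apply: connect_sub (conn u v) => x y.
by move=> /del_adj_adj; apply: connect1.
Qed.

Lemma path_del_edgeP u p : path (@adj G) u p ->
  path (del_adj e) u p \/
  exists p1 z p2, p = p1 ++ z :: p2 /\ [set last u p1; z] = e.
Proof.
elim: p u => [|a p IH] u /=; first by left.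
move=> /andP[ua /IH[H|[p1 [z [p2 [-> E]]]]]].
  have [E|nE] := eqVneq [set u; a] e; first by right; exists [::], a, p.
  by left; rewrite /del_adj ua nE.
by right; exists (a :: p1), z, p2.
Qed.

Lemma path_avoid_del_edge u p w : w \in e -> w \notin u :: p ->
  path (@adj G) u p -> path (del_adj e) u p.
Proof.
move=> we; elim: p u => [//|a p IH] u /=.
rewrite in_cons negb_or => /andP[wu wp] /andP[ua pp].
rewrite /del_adj ua IH // andbT /=.
apply: contraTneq we => <-; rewrite !inE negb_or wu /=.
by move: wp; rewrite in_cons negb_or => /andP[].
Qed.

Lemma total_mutual_visibility_set_add_edge (X : {set G}) :
  connected G -> total_mutual_visibility_set (X : {set del_edge e}) ->
  total_mutual_visibility_set (X :\: e).
Proof.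
move=> [_ conn] tX u v.
have [q [qp ql qmin] qX] := visible_geodesic (tX u v).
have [p gp] := exists_geodesic (conn u v).
have [[_ _ pu] _] := iffRL (is_shortest_pathP u v p) gp.
have [pp pl pmin] := gp.
have [pd|[p1 [z [p2 [defp defe]]]]] := path_del_edgeP pp.
  (* A geodesic [p] of [G] survives in [G - e], so the two distances agree and the geodesic [q] of
     [G - e] is one of [G] as well. *)
  apply: (@geodesic_visible G _ _ _ q).
    split=> //; first exact: (sub_path (@del_adj_adj) qp).
    by move=> r rp rl; apply: leq_trans (qmin p pd pl) (pmin r rp rl).
  by move=> w wq; rewrite inE => /andP[_]; apply: qX.
subst p; set w := last u p1 in defe.
move: pp pl; rewrite cat_path last_cat /= -/w => /and3P[p1p wz p2p] p2l.
move: pu; rewrite -cat_cons cat_uniq => /and3P[_ dis _].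
have we : w \in e by rewrite -defe set21.
have ze : z \in e by rewrite -defe set22.
(* Since [p] repeats no vertex, its part before the crossing misses [z] and its part after misses
   [w]; hence neither uses [e], and both compete with geodesics of [G - e]. *)
have p1d : path (del_adj e) u p1.
  by apply: path_avoid_del_edge ze _ p1p; move/hasPn: dis; apply; rewrite mem_head.
have p2d : path (del_adj e) z p2.
  apply: path_avoid_del_edge we _ p2p; apply/negP => wp2.
  by move/hasPn: dis => /(_ _ wp2); rewrite /w mem_last.
have [q1 [q1p q1l q1min] q1X] := visible_geodesic (tX u w).
have [q2 [q2p q2l q2min] q2X] := visible_geodesic (tX z v).
apply: (@geodesic_visible G _ _ _ (q1 ++ z :: q2)); first split.
- rewrite cat_path /= q1l wz /= (sub_path (@del_adj_adj) q1p).
  exact: (sub_path (@del_adj_adj) q2p).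
- by rewrite last_cat.
- move=> r rp rl; apply: leq_trans (pmin r rp rl).
  by rewrite !size_cat /= leq_add ?ltnS ?q1min ?q2min.
(* The junction vertices [w] and [z] may lie in [X], but they are ends of [e] and so not in
   [X :\: e]. *)
move=> t; rewrite -cat_cons mem_cat in_setD => /orP[tq|tq] /andP[te tXt].
  by have [->|E] := q1X t tq tXt; [left|rewrite E we in te].
by have [E|->] := q2X t tq tXt; [rewrite E ze in te|right].
Qed.

Lemma mu_t_del_edge_le : connected G -> #|e| <= 2 ->
  mu_t (del_edge e) <= mu_t G + 2.
Proof.
move=> conn e2; apply/mu_t_leqP => X tX.
rewrite -(cardsID e X) addnC leq_add //.
  exact/leq_mu_t/total_mutual_visibility_set_add_edge.
exact: leq_trans (subset_leq_card (subsetIr _ _)) e2.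
Qed.

End EdgeDeletion.

Lemma card_edge_le2 (G : sgraph) (e : {set G}) : e \in edges G -> #|e| <= 2.
Proof. by move=> /imset2P[x y _ _ ->]; rewrite cards2; case: (x != y). Qed.

(** * Sharpness: the 5-cycle *)

Section Cycle5.

Definition cycle5_adj : rel 'I_5 := fun i j => (ordS i == j) || (ordS j == i).

Lemma cycle5_adj_sym : symmetric cycle5_adj.
Proof. by move=> i j; rewrite /cycle5_adj orbC. Qed.

Lemma cycle5_adj_irrefl : irreflexive cycle5_adj.
Proof. by case=> [[|[|[|[|[|]]]]] //]. Qed.

Definition cycle5 : sgraph := SGraph cycle5_adj_sym cycle5_adj_irrefl.

Definition cycle5_edge : {set cycle5} := [set (ord0 : 'I_5); (ord_max : 'I_5)].

Lemma cycle5_edge_in : cycle5_edge \in edges cycle5.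
Proof. by apply/imset2P; exists (ord0 : 'I_5) (ord_max : 'I_5); rewrite ?inE. Qed.

Lemma connected_path5 : connected (del_edge cycle5_edge).
Proof.
split; first by rewrite /= card_ord.
have csym : connect_sym (del_adj cycle5_edge).
  by apply: sym_connect_sym; apply: del_adj_sym.
suff H k (lt_k5 : k < 5) :
    connect (del_adj cycle5_edge) (ord0 : 'I_5) (Ordinal lt_k5).
  move=> [u ult] [v vlt]; apply: connect_trans (H v vlt).
  by rewrite /= csym; apply: H.
elim: k lt_k5 => [|k IH] lt_k5.
  by rewrite (_ : Ordinal lt_k5 = ord0 :> 'I_5) ?connect0 //; apply: val_inj.
apply: connect_trans (IH (ltnW lt_k5)) (connect1 _).
rewrite /del_adj eq_set2.
by case: k lt_k5 {IH} => [|[|[|[|k]]]].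
Qed.

Lemma mu_t_cycle5 : mu_t cycle5 = 0.
Proof.
apply: mu_t_eq0 => X w tX.
apply: (@unique_middle_notin cycle5 X (ord_pred w) (ordS w) w) => //.
1-4: by case: w => [[|[|[|[|[|?]]]]] ?].
move=> z; move: w z.
by case=> [[|[|[|[|[|?]]]]] ?]; case=> [[|[|[|[|[|?]]]]] ?] //=; move=> *; apply: val_inj.
Qed.

Lemma path5_leaves : total_mutual_visibility_set (cycle5_edge : {set del_edge cycle5_edge}).
Proof.
apply: leaves_total_mutual_visibility_set; first exact: connected_path5.
move=> x y z; rewrite !inE /= /del_adj !eq_set2 => /orP[]/eqP-> {x};
case: y => [[|[|[|[|[|?]]]]] ?] //; case: z => [[|[|[|[|[|?]]]]] ?] //;
by move=> *; apply: val_inj.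
Qed.

Lemma mu_t_path5 : mu_t (del_edge cycle5_edge) = mu_t cycle5 + 2.
Proof.
apply/eqP; rewrite eqn_leq mu_t_del_edge_le /=.
- by rewrite mu_t_cycle5; have := leq_mu_t path5_leaves; rewrite cards2.
- exact: connected_del_edge connected_path5.
- exact: card_edge_le2 cycle5_edge_in.
Qed.

End Cycle5.

(** * No linear lower bound: the prism over a star *)

Section StarPrism.
Variable n : nat.

(* [(s, None)] is the center of the star [s], [(s, Some i)] its [i]-th leaf;
   there are [n.+2] leaves, so that the center is not itself a leaf. *)
Definition star_prism_adj : rel (bool * option 'I_n.+2) := fun x y =>
  if x.1 == y.1 then isSome x.2 (+) isSome y.2 else x.2 == y.2.

Lemma star_prism_adj_sym : symmetric star_prism_adj.
Proof. by move=> x y; rewrite /star_prism_adj eq_sym addbC (eq_sym x.2). Qed.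

Lemma star_prism_adj_irrefl : irreflexive star_prism_adj.
Proof. by move=> x; rewrite /star_prism_adj eqxx addbb. Qed.

Definition star_prism : sgraph := SGraph star_prism_adj_sym star_prism_adj_irrefl.

Definition star_prism_edge : {set star_prism} :=
  [set (false, None : option 'I_n.+2); (true, None : option 'I_n.+2)].

Lemma star_prism_edge_in : star_prism_edge \in edges star_prism.
Proof.
by apply/imset2P; exists (false, None : option 'I_n.+2) (true, None : option 'I_n.+2);
  rewrite ?inE.
Qed.

Lemma del_star_prism_adjE (x y : bool * option 'I_n.+2) :
  del_adj star_prism_edge x y =
  if x.1 == y.1 then isSome x.2 (+) isSome y.2 else isSome x.2 && (x.2 == y.2).
Proof.
case: x y => [s o] [t o']; rewrite /del_adj eq_set2 /= /star_prism_adj !xpair_eqE.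
by case: s t o o' => [] [] [i|] [j|] //=; rewrite ?andbT ?andbF.
Qed.

Lemma connected_del_star_prism : connected (del_edge star_prism_edge).
Proof.
split; first by apply/card_gt0P; exists (false, None : option 'I_n.+2).
have csym : connect_sym (del_adj star_prism_edge).
  by apply: sym_connect_sym; apply: del_adj_sym.
have leaf s (o : option 'I_n.+2) : connect (del_adj star_prism_edge) (s, None) (s, o).
  case: o => [i|]; last exact: connect0.
  by apply: connect1; rewrite del_star_prism_adjE /= eqxx.
have centers : connect (del_adj star_prism_edge)
    (false, None : option 'I_n.+2) (true, None : option 'I_n.+2).
  (* With [e] gone, the centers are joined by a detour through a matched pair of leaves. *)
  apply: connect_trans (leaf false (Some ord0)) _.
  rewrite csym; apply: connect_trans (leaf true (Some ord0)) _.
  by apply: connect1; rewrite del_star_prism_adjE /= eqxx.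
have H (x : star_prism) :
    connect (del_adj star_prism_edge) (false, None : option 'I_n.+2) x.
  by case: x => [[] o]; [apply: connect_trans centers _|]; apply: leaf.
by move=> u v; apply: connect_trans (H v); rewrite /= csym; apply: H.
Qed.

(** The metric of a Cartesian product: the distance in the edge between the two copies plus the
    distance in the star, where two distinct leaves are 2 apart. *)
Definition star_prism_dist (x y : bool * option 'I_n.+2) : nat :=
  (x.1 != y.1) + (if x.2 == y.2 then 0 else if isSome x.2 && isSome y.2 then 2 else 1).

Lemma star_prism_dist_adj (x y z : bool * option 'I_n.+2) :
  star_prism_adj y z -> star_prism_dist x z <= star_prism_dist x y + 1.
Proof.
rewrite /star_prism_adj /star_prism_dist.
case: x y z => [s [i|]] [t [j|]] [r [k|]] /=;
  rewrite ?(inj_eq Some_inj); case: s; case: t; case: r => //=;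
  try (by move=> /eqP->; case: eqP); by repeat case: eqP.
Qed.

Lemma star_prism_leaves :
  total_mutual_visibility_set
    ([set x : bool * option 'I_n.+2 | isSome x.2] : {set star_prism}).
Proof.
move=> u v.
(* It suffices to give a walk with only centers in its interior, no longer than the explicit
   distance; the Lipschitz bound then makes it a geodesic. *)
suff [p [pp pl ps pX]] : exists p : seq star_prism,
    [/\ path star_prism_adj u p, last u p = v, size p <= star_prism_dist u v &
      forall z, z \in u :: p -> isSome z.2 -> z = u \/ z = v].
  apply: (@geodesic_visible _ _ _ _ p); last first.
    by move=> z zp; rewrite inE; apply: pX.
  split=> // q qp ql; apply: leq_trans ps _.
  have := @path_lipschitz star_prism (star_prism_dist u) u q _ qp.
  rewrite ql /star_prism_dist !eqxx /=; apply=> x y.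
  exact: star_prism_dist_adj.
have [->|uv] := eqVneq u v.
  by exists [::]; split=> // z; rewrite inE => /eqP; left.
have [uv_adj|uv_nadj] := boolP (star_prism_adj u v).
  exists [:: v]; split=> //=; first by rewrite uv_adj.
    rewrite /star_prism_dist; move: uv uv_adj; rewrite /star_prism_adj.
    case: u v => [s o] [t o'] /=; rewrite xpair_eqE.
    by case: (s == t); case: (o == o') => //= _; case: o => //; case: o'.
  by move=> z; rewrite !inE => /orP[]/eqP; auto.
(* Distinct nonadjacent vertices of the same star are two leaves, joined through their center.
   Between different stars, the walk changes copies along the edge joining the centers. *)
have [s1|s1] := eqVneq u.1 v.1.
  exists [:: (u.1, None); v]; move: uv uv_nadj s1.
  case: u v => [s [i|]] [t [j|]] /=; rewrite /star_prism_adj /star_prism_dist /=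
    => uv nuv st; move: uv nuv; rewrite -{}st !eqxx //= xpair_eqE eqxx //=.
  move=> /negPf ->; split=> //= z; rewrite !inE => /or3P[]/eqP -> //=; auto.
have ts : v.1 = ~~ u.1 by move: s1; case: (u.1); case: (v.1).
case: u v s1 ts uv_nadj {uv} => [s [i|]] [t [j|]] /= s1 ts; rewrite {}ts {t s1};
  rewrite /star_prism_adj /star_prism_dist /= => uv_nadj.
- exists [:: (s, None); (~~ s, None); (~~ s, Some j)].
  split=> //=; rewrite ?eqxx //=; try by case: s {uv_nadj}.
    by case: s uv_nadj => /= /negPf ->.
  by move=> z; rewrite !inE => /or4P[]/eqP -> //=; auto.
- exists [:: (s, None); (~~ s, None)].
  split=> //=; rewrite ?eqxx //=; try by case: s {uv_nadj}.
  by move=> z; rewrite !inE => /or3P[]/eqP -> //=; auto.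
- exists [:: (~~ s, None); (~~ s, Some j)].
  split=> //=; rewrite ?eqxx //=; try by case: s {uv_nadj}.
  by move=> z; rewrite !inE => /or3P[]/eqP -> //=; auto.
- by case: s uv_nadj.
Qed.

Lemma leq_mu_t_star_prism : n <= mu_t star_prism.
Proof.
apply: leq_trans (leq_mu_t star_prism_leaves).
have inj : injective (fun i : 'I_n.+2 => (true, Some i)) by move=> i j [].
have le_n : n <= #|[set (true, Some i) | i : 'I_n.+2]|.
  by rewrite card_imset // card_ord ltnW.
apply: leq_trans le_n (subset_leq_card _).
by apply/subsetP => x /imsetP[i _ ->]; rewrite inE.
Qed.

Lemma mu_t_del_star_prism : mu_t (del_edge star_prism_edge) = 0.
Proof.
apply: mu_t_eq0 => X [s [i|]] tX.
  (* A leaf is the middle between its center and its mirror image: the other route would need the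
     deleted edge. *)
  apply: (@unique_middle_notin (del_edge star_prism_edge) X
    (s, None) (~~ s, Some i)) => //=;
  rewrite ?xpair_eqE ?del_star_prism_adjE /=; try by case: s; rewrite ?eqxx.
  move=> [t [k|]]; rewrite !del_star_prism_adjE /=; case: s; case: t => //= _.
    by move=> /eqP ->.
  by move=> /eqP ->.
(* A center is the middle between two leaves of its star. *)
apply: (@unique_middle_notin (del_edge star_prism_edge) X
    (s, Some ord0) (s, Some (lift ord0 ord0))) => //=;
  rewrite ?xpair_eqE ?del_star_prism_adjE /=; try by case: s; rewrite ?eqxx.
move=> [t [k|]]; rewrite !del_star_prism_adjE /=; case: s; case: t => //=.
  by move=> /eqP <- /eqP.
by move=> /eqP <- /eqP.
Qed.

End StarPrism.

Theorem theorem3p4 (R : realType) :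
  [/\ (forall (G : sgraph) (e : {set G}),
         connected G -> e \in edges G -> connected (del_edge e) ->
         mu_t (del_edge e) <= mu_t G + 2),
      (exists (G : sgraph) (e : {set G}),
         [/\ connected G, e \in edges G, connected (del_edge e) &
             mu_t (del_edge e) = mu_t G + 2]) &
      ~ (exists a b : R, (0 < a)%R /\
           forall (G : sgraph) (e : {set G}),
             connected G -> e \in edges G -> connected (del_edge e) ->
             (a * (mu_t G)%:R + b <= (mu_t (del_edge e))%:R)%R)].
Proof.
split.
- by move=> G e conn eG _; apply: mu_t_del_edge_le => //; apply: card_edge_le2.
- exists cycle5, cycle5_edge; split.
  + exact: connected_del_edge connected_path5.
  + exact: cycle5_edge_in.
  + exact: connected_path5.
  + exact: mu_t_path5.
case=> a [b [a0 H]].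
(* Chosen so that [n], and hence [mu_t (star_prism n)], exceeds [- b / a]; the left side of the
   assumed bound is then positive, while its right side is 0. *)
pose n := Num.bound `|- b / a|%R.
have := H (star_prism n) (star_prism_edge n)
  (connected_del_edge (connected_del_star_prism n))
  (star_prism_edge_in n) (connected_del_star_prism n).
rewrite mu_t_del_star_prism; apply/negP; rewrite -ltNge.
have : (- b / a < (mu_t (star_prism n))%:R)%R.
  apply: le_lt_trans (ler_norm _) _.
  by apply: lt_le_trans (archi_boundP (normr_ge0 _)) _; rewrite ler_nat leq_mu_t_star_prism.
by rewrite ltr_pdivrMr // mulrC -subr_gt0 opprK.
Qed.
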